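(* Let $n\ge 5$, let $a_0,\dots,a_{n-1}$ be algebraically independent indeterminates over $\mathbb{Q}$, and let $K=\mathbb{Q}(a_0,\dots,a_{n-1})$. Then the general polynomial of degree $n$, $x^n+a_{n-1}x^{n-1}+\dots+a_1x+a_0\in K[x]$, is not solvable in radicals over $K$.
   Context: A polynomial over a field $K$ is solvable in radicals over $K$ if there is a tower of fields $K=L_0\subset L_1\subset\dots\subset L_s$ such that $L_{j+1}=L_j(\rho_j)$ with $\rho_j^{m_j}\in L_j$ for some integer $m_j\ge 1$, and the polynomial splits into linear factors over $L_s$. *)

(* Defs.v *)
From HB Require Import structures.
From mathcomp Require Import all_boot all_order all_algebra all_field.
From mathcomp Require Import mpoly.

Set Implicit Arguments.
Unset Strict Implicit.
Unset Printing Implicit Defensive.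

Import GRing.Theory.
Local Open Scope ring_scope.

Definition radical_step (K : fieldType) (L : fieldExtType K)
    (E F : {subfield L}) : Prop :=
  exists (rho : L) (m : nat),
    [/\ (0 < m)%N, rho ^+ m \in E & F = <<E; rho>>%AS].

(* [%=] is equality up to a nonzero constant factor, which accounts for the
   leading coefficient of [p]. *)
Definition splits_over (K : fieldType) (L : fieldExtType K)
    (E : {subfield L}) (p : {poly K}) : Prop :=
  exists rs : seq L,
    {subset rs <= E} /\
    map_poly (in_alg L) p %= \prod_(r <- rs) ('X - r%:P).

(* Every field of a radical tower over [K] has finite degree over [K], so the
   tower is taken inside one finite extension [L]; the subfield [1%AS] of [L]
   is the image of [K]. The values [E j] with [s < j] are irrelevant. *)
Definition solvable_in_radicals (K : fieldType) (p : {poly K}) : Prop :=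
  exists (L : fieldExtType K) (s : nat) (E : nat -> {subfield L}),
    [/\ E 0%N = 1%AS,
        forall j : nat, (j < s)%N -> radical_step (E j) (E j.+1)
      & splits_over (E s) p].

Definition rat_funs (n : nat) : fieldType := {fraction {mpoly rat[n]}}.

(* The indeterminate a_i, where [i : 'I_n], as an element of Q(a_0, ..., a_(n-1)). *)
Definition indet (n : nat) (i : 'I_n) : rat_funs n := tofrac ('X_i : {mpoly rat[n]}).

Definition general_poly (n : nat) : {poly rat_funs n} :=
  'X^n + \sum_(i < n) (indet i)%:P * 'X^i.

(* Main.v *)
From HB Require Import structures.
Require Import Defs.
From mathcomp Require Import all_boot all_order all_algebra all_fingroup.
From mathcomp Require Import all_solvable all_field.
From mathcomp Require Import fraction generic_quotient mpoly.
From Stdlib Require Import Classical.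

(* Embed a radical tower over K, with steps rho^m in the previous field for a
   common exponent m, in a finite normal extension Omega of K that contains a
   primitive m-th root of unity zeta. Automorphisms of Omega over K send zeta
   to a power of itself; those that fix zeta and a field E of the tower
   multiply rho by a power of zeta. Hence they commute on zeta, resp. on rho,
   so each derived subgroup fixes one more field of the tower, and some term of
   the derived series of Gal(Omega/K) fixes all roots of a solvable polynomial.

   The roots of the general polynomial are algebraically independent over Q:
   if q vanishes at the roots, the product of the conjugates of q under S_n is
   a polynomial in the coefficients a_i that vanishes, hence is 0. Therefore
   every permutation of the roots is induced by an automorphism, and the same
   term of the derived series of S_n is trivial, which is false for n >= 5. *)

Set Implicit Arguments.
Unset Strict Implicit.
Unset Printing Implicit Defensive.

Import GRing.Theory.
Local Open Scope ring_scope.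

(** * Splitting fields and roots of unity *)

Lemma irreducible_factor (F : fieldType) (p : {poly F}) :
  (1 < size p)%N -> exists2 r, irreducible_poly r & r %| p.
Proof.
have [n] := ubnP (size p); elim: n p => // n IHn p /ltnSE-le_p_n p_gt1.
(* There is no factorization algorithm over an arbitrary field. *)
have [irr_p | red_p] := classic (irreducible_poly p); first by exists p.
have [q [q_neq1 q_dv_p neq_qp]] :
    exists q : {poly F}, [/\ size q != 1%N, q %| p & ~~ (q %= p)].
  apply: NNPP => no_q; apply: red_p; split=> // q q_neq1 q_dv_p.
  by apply: contraT => neq_qp; case: no_q; exists q.
have p_neq0 : p != 0 by rewrite -size_poly_gt0 ltnW.
have lt_qp : (size q < size p)%N.
  by rewrite ltn_neqAle dvdp_leq // (dvdp_size_eqp q_dv_p) neq_qp.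
have q_gt1 : (1 < size q)%N.
  by rewrite ltn_neqAle eq_sym q_neq1 size_poly_gt0 (dvdpN0 q_dv_p).
have [|r irr_r r_dv_q] := IHn q _ q_gt1; first exact: leq_trans le_p_n.
by exists r => //; apply: dvdp_trans q_dv_p.
Qed.

(** Adjoin a root of an irreducible factor, divide it out and recurse over the larger field [K]; the
    extension found over [K] is then viewed over [F]. *)
Lemma splitting_ext (F : fieldType) (p : {poly F}) : p != 0 ->
  exists (L : fieldExtType F) (zs : seq L),
    map_poly (in_alg L) p %= \prod_(z <- zs) ('X - z%:P).
Proof.
have [n] := ubnP (size p); elim: n => // n IHn in F p * => /ltnSE-le_p_n p_neq0.
have [p_le1 | p_gt1] := leqP (size p) 1.
  exists F^o, [::].
  by rewrite big_nil -size_poly_eq1 size_map_poly eqn_leq p_le1 size_poly_gt0.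
have [r irr_r r_dv_p] := irreducible_factor p_gt1.
have [K _ [x rx0 _]] := irredp_FAdjoin irr_r.
have /factor_theorem[q Dp] : root (map_poly (in_alg K) p) x.
  by rewrite -(divpK r_dv_p) rmorphM rootM rx0 orbT.
have Dszp : size p = size (q * ('X - x%:P)) by rewrite -Dp size_map_poly.
have q_neq0 : q != 0.
  by move: p_neq0; rewrite -size_poly_eq0 Dszp size_poly_eq0 mulf_eq0 => /norP[].
have [|L [zs Dq]] := IHn K q _ q_neq0.
  by rewrite Dszp size_mul ?polyXsubC_eq0 // size_XsubC addn2 in le_p_n.
exists (baseFieldType L), (in_alg L x :: zs).
suffices : map_poly (in_alg L) (map_poly (in_alg K) p) %=
             \prod_(z <- in_alg L x :: zs) ('X - z%:P).
  rewrite -map_poly_comp.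
  by rewrite -(eq_map_poly (fun a : F => baseField_scaleE a (1 : L))).
rewrite big_cons Dp mulrC rmorphM /= rmorphB /= map_polyX map_polyC.
exact: eqp_mull.
Qed.

(** [L] may be larger than what the roots generate; the subfield that they do generate is a
    splitting field, with inclusion [j]. *)
Lemma splitting_subfield (K : fieldType) (L : fieldExtType K) (p : {poly K})
    (zs : seq L) :
    map_poly (in_alg L) p %= \prod_(z <- zs) ('X - z%:P) ->
  exists (Omega : splittingFieldType K) (j : {rmorphism Omega -> L}),
    (forall c : K, j c%:A = c%:A) /\
    (forall y, y \in <<1 & zs>>%VS -> exists u, y = j u).
Proof.
move=> Dp; pose Lp : fieldExtType K := subvs_of <<1 & zs>>.
pose j : {rmorphism Lp -> L} := vsval : Lp -> L.
have j_alg (c : K) : j c%:A = c%:A by rewrite /= algid1.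
pose ts : seq Lp := map (vsproj <<1 & zs>>) zs.
have Dts : map j ts = zs.
  by rewrite -map_comp map_id_in // => y zs_y; rewrite /= vsprojK ?seqv_sub_adjoin.
have splitLp : SplittingField.axiom Lp.
  exists (map_poly (in_alg Lp) p); first by apply/polyOver1P; exists p.
  exists ts.
    rewrite -(eqp_map j) -map_poly_comp.
    rewrite (eq_map_poly (g := in_alg L)); last exact: j_alg.
    rewrite rmorph_prod (eq_bigr (fun t => 'X - (j t)%:P)); last first.
      by move=> t _; rewrite rmorphB /= map_polyX map_polyC.
    by rewrite -(big_map j xpredT (fun z => 'X - z%:P)) Dts.
  (* That [ts] generates [Lp] is checked on images in [L], where [ts] becomes [zs]. *)
  pose toL := linfun (vsval : Lp -> L); apply/vspaceP=> u.
  have : val u \in (toL @: <<1 & ts>>)%VS.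
    rewrite aimg_adjoin_seq aimg1.
    have -> : map toL ts = zs.
      by rewrite -[RHS]Dts; apply: eq_map => y; rewrite lfunE.
    exact: valP.
  by case/memv_imgP=> v ts_v; rewrite memvf lfunE => /val_inj->.
pose M := FieldExt_isSplittingField.Build K Lp splitLp.
pose Omega : splittingFieldType K := HB.pack Lp M.
exists Omega, j; split=> // y zs_y.
by exists (vsproj <<1 & zs>>%VS y); rewrite /j /= vsprojK.
Qed.

Lemma splitting_ext_prim_root (K : fieldType) (L : fieldExtType K) (m : nat) :
    m%:R != 0 :> K ->
  exists (Omega : splittingFieldType K) (iota : {rmorphism L -> Omega})
    (zeta : Omega),
    (forall c : K, iota c%:A = c%:A) /\ m.-primitive_root zeta.
Proof.
move=> m_neq0.
have m_gt0 : (0 < m)%N by case: m m_neq0; rewrite ?eqxx.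
pose b : seq L := vbasis {:L}.
have minK (y : L) : exists q : {poly K}, minPoly 1 y = map_poly (in_alg L) q.
  have /polyOver1P[q ->] := minPolyOver 1 y.
  by exists q.
(* The basis elements of [L] are among the roots of [P], so a splitting field of [P] receives all of
   [L]; the factor ['X^m - 1] supplies the roots of unity. *)
pose P : {poly K} := (\prod_(y <- b) sval (sig_eqW (minK y))) * ('X^m - 1).
have P_neq0 : P != 0.
  apply: mulf_neq0; last by rewrite monic_neq0 ?monicXnsubC.
  rewrite prodf_seq_neq0; apply/allP => y _; case: sig_eqW => q /= Dq.
  by rewrite -(map_poly_eq0 (in_alg L)) -Dq monic_neq0 ?monic_minPoly.
have [|L1 [zs Dzs]] := @splitting_ext L (map_poly (in_alg L) P).
  by rewrite map_poly_eq0.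
pose L0 : fieldExtType K := baseFieldType L1.
have in_alg_comp (c : K) : in_alg L1 (in_alg L c) = (in_alg L0 c : L1).
  exact: esym (baseField_scaleE c (1 : L1)).
have DP : map_poly (in_alg L0) P %= \prod_(z <- (zs : seq L0)) ('X - z%:P).
  by rewrite -(eq_map_poly in_alg_comp) map_poly_comp.
have [Omega [j [j_alg jP]]] := splitting_subfield DP.
have b_zs (y : L) : y \in b -> (in_alg L1 y : L0) \in (zs : seq L0).
  move=> b_y; rewrite -root_prod_XsubC -(eqp_root DP).
  rewrite -(eq_map_poly in_alg_comp) map_poly_comp.
  rewrite (fmorph_root (in_alg L1)) rmorphM rootM rmorph_prod /=.
  apply/orP; left; rewrite rootE horner_prod prodf_seq_eq0; apply/hasP.
  by exists y => //=; case: sig_eqW => q /= <-; apply: root_minPoly.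
have in_j (y : L) : exists u, (in_alg L1 y : L0) == j u.
  have [|u ->] := jP (in_alg L1 y : L0); last by exists u.
  rewrite (coord_vbasis (memvf y)) rmorph_sum memv_suml // => i _.
  rewrite -mulr_algl rmorphM [X in X * _]in_alg_comp mulr_algl.
  by apply/memvZ/seqv_sub_adjoin/b_zs/mem_nth; rewrite size_tuple.
(* As [j] is injective, preimages under it are unique, which makes [iota] respect the ring
   operations. *)
pose iota y := xchoose (in_j y).
have j_iota y : j (iota y) = (in_alg L1 y : L0) by apply/esym/eqP/(xchooseP (in_j y)).
have iota_zmod : zmod_morphism iota.
  by move=> y z; apply: (fmorph_inj j); rewrite rmorphB !j_iota rmorphB.
have iota_monoid : monoid_morphism iota.
  split=> [|y z]; apply: (fmorph_inj j); first by rewrite rmorph1 j_iota rmorph1.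
  by rewrite rmorphM !j_iota rmorphM.
pose iA := GRing.isZmodMorphism.Build L Omega iota iota_zmod.
pose iM := GRing.isMonoidMorphism.Build L Omega iota iota_monoid.
pose iotaM : {rmorphism L -> Omega} := HB.pack iota iA iM.
exists Omega, iotaM.
have iota_alg (c : K) : iotaM c%:A = c%:A.
  by apply: (fmorph_inj j); rewrite j_iota j_alg; apply: in_alg_comp.
have [ts Dts] : exists ts : seq Omega, 'X^m - 1 = \prod_(t <- ts) ('X - t%:P).
  have [w Dw] : exists w, 'X^m - 1 = \prod_(z <- mask w (zs : seq L0)) ('X - z%:P).
    have : ('X^m - 1 : {poly L0}) %| \prod_(z <- (zs : seq L0)) ('X - z%:P).
      rewrite -(eqp_dvdr _ DP) rmorphM /= rmorphB rmorphXn /= map_polyX rmorph1.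
      exact: dvdp_mulIr.
    case/dvdp_prod_XsubC=> w; rewrite eqp_monic ?monic_prod_XsubC ?monicXnsubC //.
    by move/eqP; exists w.
  have lift_j (r : seq L0) : {subset r <= (zs : seq L0)} -> exists ts, map j ts = r.
    elim: r => [|z r IHr] r_zs; first by exists [::].
    have [|u Du] := jP z; first by rewrite seqv_sub_adjoin ?r_zs ?mem_head.
    have [|ts Dts] := IHr; first by move=> y r_y; rewrite r_zs ?inE ?r_y ?orbT.
    by exists (u :: ts); rewrite /= -Du Dts.
  have [|ts Dts] := lift_j (mask w zs); first by move=> z /mem_mask.
  exists ts; apply: (map_poly_inj j).
  rewrite rmorphB rmorphXn /= map_polyX rmorph1 Dw -Dts big_map rmorph_prod.
  by apply: eq_bigr => t _; rewrite rmorphB /= map_polyX map_polyC.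
(* Since [m] is nonzero in [K], ['X^m - 1] is separable; its [m] distinct roots include a primitive
   one. *)
have /hasP[zeta _ zeta_prim] : has m.-primitive_root ts.
  have size_ts : size ts = m.
    apply: succn_inj.
    by rewrite -(size_prod_XsubC _ id) -Dts size_XnsubC.
  apply: has_prim_root => //; last by rewrite size_ts.
    apply/allP=> t; rewrite -root_prod_XsubC -Dts.
    by rewrite /root !hornerE subr_eq0 unity_rootE.
  rewrite -separable_prod_XsubC -Dts cyclotomic.separable_Xn_sub_1 //.
  by rewrite -(rmorph_nat (in_alg Omega)) fmorph_eq0.
by exists zeta.
Qed.

(** * Derived subgroups acting on radical towers *)

(** The automorphisms fixing [a] form a subgroup, so it suffices to check commutators of elements of
    [G]. *)
Lemma gal_commg_fixed (K : fieldType) (L : splittingFieldType K)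
    (G : {group gal_of {:L}}) (a : L) :
    (forall g h, g \in G -> h \in G -> g (h a) = h (g a)) ->
  forall g, g \in [~: G, G]%g -> g a = a.
Proof.
move=> comm_a g; pose A := [set x : gal_of {:L} | x a == a].
have groupA : group_set A.
  apply/group_setP; split=> [|x y]; rewrite !inE ?gal_id // galM ?memvf //.
  by move=> /eqP-> /eqP->.
suffices /subsetP sub_A : [~: G, G]%g \subset A by move/sub_A; rewrite inE => /eqP.
rewrite (gen_subG _ (Group groupA)); apply/subsetP => _ /imset2P[x y Gx Gy ->].
rewrite inE /commg /conjg !mulgA !galM ?memvf //.
by rewrite comm_a ?groupV // -(galM x^-1%g) ?memvf // mulVg gal_id
  -(galM y^-1%g) ?memvf // mulVg gal_id.
Qed.

Lemma gal_root_of_unity (K : fieldType) (L : splittingFieldType K)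
    (g : gal_of {:L}) (m : nat) (zeta a : L) :
    m.-primitive_root zeta -> g (a ^+ m) = a ^+ m ->
  exists i : nat, g a = zeta ^+ i * a.
Proof.
move=> zeta_prim g_am; have [-> | a_neq0] := eqVneq a 0.
  by exists 0%N; rewrite rmorph0 mulr0.
have ga_m : g a ^+ m = a ^+ m by rewrite -g_am rmorphXn.
have /(prim_rootP zeta_prim)[i Di] : (g a / a) ^+ m = 1.
  by rewrite expr_div_n ga_m divff // expf_neq0.
by exists i; rewrite -Di divfK.
Qed.

(** The product of the exponents of all steps works for each step, since a power of an element of a
    field stays in it. *)
Lemma radical_tower_exponent (K : fieldType) (L : fieldExtType K) (s : nat)
    (E : nat -> {subfield L}) :
    (forall j, (j < s)%N -> radical_step (E j) (E j.+1)) ->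
  exists2 m, (0 < m)%N & forall j, (j < s)%N ->
    exists2 rho, rho ^+ m \in E j & E j.+1 = <<E j; rho>>%AS.
Proof.
elim: s => [|s IHs] radE; first by exists 1%N.
have [|m m_gt0 Em] := IHs; first by move=> j lt_js; apply/radE/ltnW.
have [rho [k [k_gt0 rho_k Ds]]] := radE s (ltnSn s).
exists (m * k)%N => [|j]; first by rewrite muln_gt0 m_gt0.
rewrite ltnS leq_eqVlt => /predU1P[-> | /Em[rho1 rho1_m Dj]].
  by exists rho => //; rewrite mulnC exprM rpredX.
by exists rho1 => //; rewrite exprM rpredX.
Qed.

Lemma solvable_in_radicals_der (K : fieldType) (p : {poly K}) :
    [pchar K] =i pred0 -> solvable_in_radicals p ->
  exists (Omega : splittingFieldType K) (rs : seq Omega) (k : nat),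
    map_poly (in_alg Omega) p %= \prod_(r <- rs) ('X - r%:P) /\
    forall g r, g \in ('Gal({:Omega} / 1)^`(k))%g -> r \in rs -> g r = r.
Proof.
move=> pcharK [L [s [E [E0 radE [rs [rs_E Dp]]]]]].
have [m m_gt0 Em] := radical_tower_exponent radE.
have m_neq0 : m%:R != 0 :> K by rewrite ((pcharf0P K).1 pcharK) -lt0n.
have [Omega [iota [zeta [iota_alg zeta_prim]]]] := splitting_ext_prim_root L m_neq0.
(* One derived subgroup is spent on [zeta] and one on each of the [s] radical steps. *)
exists Omega, (map iota rs), s.+1; split.
  move: Dp; rewrite -(eqp_map iota) -map_poly_comp.
  rewrite (eq_map_poly (g := in_alg Omega)); last exact: iota_alg.
  rewrite rmorph_prod big_map => /eqp_trans; apply.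
  by rewrite (eq_bigr (fun r => 'X - (iota r)%:P)) ?eqpxx // => r _;
    rewrite rmorphB /= map_polyX map_polyC.
pose G k := ('Gal({:Omega} / 1)^`(k))%G.
suffices fixE j : (j <= s)%N -> forall g, g \in G j.+1 ->
    g zeta = zeta /\ {in E j, forall y, g (iota y) = iota y}.
  by move=> g _ /(fixE s (leqnn s))[_ g_E] /mapP[r /rs_E/g_E ? ->].
elim: j => [|j IHj] lt_js g.
  rewrite /G /= dergSn => Gg; split.
    apply: (gal_commg_fixed _ Gg) => h h' _ _.
    have pow (x : gal_of {:Omega}) : exists i, x zeta = zeta ^+ i.
      have [|i Di] := gal_root_of_unity (g := x) (a := zeta) zeta_prim.
        by rewrite prim_expr_order // rmorph1.
      by exists i.+1; rewrite exprSr.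
    have [[i Di] [i' Di']] := (pow h, pow h').
    by rewrite Di' Di !rmorphXn /= Di Di' -!exprM mulnC.
  rewrite E0 => _ /vlineP[c ->]; rewrite iota_alg.
  by rewrite linearZ /= rmorph1.
have [fix_zeta fix_E] := (fun h Gh => proj1 (IHj (ltnW lt_js) h Gh),
                          fun h Gh => proj2 (IHj (ltnW lt_js) h Gh)).
rewrite /G /= dergSn => Gg.
have Gjg : g \in G j.+1 by apply: subsetP Gg; apply: der1_subG.
split=> [|y]; first exact: fix_zeta.
have [rho rho_m ->] := Em j lt_js; case/Fadjoin_polyP=> q Eq ->.
have g_rho : g (iota rho) = iota rho.
  apply: (gal_commg_fixed _ Gg) => h h' Gh Gh'.
  have pow (x : gal_of {:Omega}) :
      x \in G j.+1 -> exists i, x (iota rho) = zeta ^+ i * iota rho.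
    move=> Gx; apply: (gal_root_of_unity zeta_prim).
    by rewrite -rmorphXn fix_E.
  have [[i Di] [i' Di']] := (pow h Gh, pow h' Gh').
  by rewrite Di' Di !rmorphM !rmorphXn /= Di Di' !fix_zeta // mulrCA.
rewrite -!horner_map /= g_rho; congr _.[_]; apply/polyP=> i.
by rewrite !coef_map /= fix_E // (polyOverP Eq).
Qed.

(** * Fractions, and composition of polynomials *)

Lemma fraction_numden (R : idomainType) (c : {fraction R}) :
  exists a b : R, b != 0 /\ tofrac b * c = tofrac a.
Proof.
elim/quotW: c => r; exists \n_r, \d_r; split; first exact: denom_ratioP.
(* Exposing the product as one of representatives reduces the equality to a cross-multiplication. *)
apply/eqP; rewrite -[_ * _]/(FracField.mul _ _) !piE FracField.equivfE.
rewrite /FracField.mulf !numden_Ratio ?mulf_neq0 ?oner_eq0 ?denom_ratioP //.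
by rewrite !mul1r mulr1.
Qed.

Lemma fraction_poly_clear_denom (R : idomainType) (p : {poly {fraction R}}) :
  exists (d : R) (q : {poly R}),
    d != 0 /\ map_poly (@tofrac R) q = tofrac d *: p.
Proof.
elim/poly_ind: p => [|p c [d [q [d_neq0 Dq]]]].
  by exists 1, 0; rewrite oner_eq0 map_poly0 scaler0.
have [a [b [b_neq0 Dc]]] := fraction_numden c.
exists (b * d), (b *: q * 'X + (d * a)%:P); split; first exact: mulf_neq0.
rewrite rmorphD rmorphM /= map_polyX map_polyC /= map_polyZ /= Dq.
rewrite !rmorphM /= -Dc scalerDr -!scalerAl scalerA; congr (_ + _).
by rewrite -polyCM mulrCA mulrA -mul_polyC -polyCM.
Qed.

Lemma comp_mpolyA (n : nat) (R : comNzRingType) (p : {mpoly R[n]})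
    (q r : n.-tuple {mpoly R[n]}) :
  p \mPo q \mPo r = p \mPo [tuple tnth q i \mPo r | i < n].
Proof.
rewrite !(comp_mpolyE p) raddf_sum; apply: eq_bigr => m _.
rewrite /= comp_mpolyZ rmorph_prod; congr (_ *: _).
by apply: eq_bigr => i _; rewrite rmorphXn tnth_mktuple.
Qed.

(** * Algebraic independence of the roots, and automorphisms permuting them *)

Section GeneralPoly.

Variables (n : nat) (L : splittingFieldType (rat_funs n)) (xs : n.-tuple L).
Hypothesis xsP :
  map_poly (in_alg L) (general_poly n) = \prod_(x <- xs) ('X - x%:P).

Local Notation A := {mpoly rat[n]}.

Let of_rat : {rmorphism rat -> L} :=
  (in_alg L \o (@tofrac A \o @mpolyC n rat) : rat -> L).
(** Two readings of the same polynomial ring: under [inA] the variables become the coefficients of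
    the general polynomial, under [ev] its roots. *)
Let inA : {rmorphism A -> L} := (in_alg L \o @tofrac A : A -> L).
Let ev : {rmorphism A -> L} := mmap of_rat (tnth xs).

Lemma ev_X i : ev 'X_i = tnth xs i.
Proof. by rewrite /ev /= mmapX mmap1U. Qed.

(* By Viete, entry [i] is the coefficient of ['X^i] in the product of the
   ['X - 'X_j]. *)
Definition signed_mesym : n.-tuple A :=
  [tuple (-1) ^+ (n - i) *: mesym n rat (n - i) | i < n].

Lemma coef_general_poly (i : 'I_n) : (general_poly n)`_i = indet i.
Proof.
rewrite /general_poly coefD coefXn ltn_eqF // add0r coef_sum (bigD1 i) //=.
rewrite coefCM coefXn eqxx mulr1 big1 ?addr0 // => j neq_ji.
by rewrite coefCM coefXn eq_sym (inj_eq val_inj) (negPf neq_ji) mulr0.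
Qed.

Lemma ev_mesym k : ev (mesym n rat k) = (mesym n L k).@[tnth xs].
Proof.
rewrite /mesym !rmorph_sum; apply: eq_bigr => h _.
by rewrite !rmorph_prod /=; apply: eq_bigr => j _; rewrite mmapX mmap1U mevalXU.
Qed.

Lemma ev_signed_mesym (i : 'I_n) : ev (tnth signed_mesym i) = inA 'X_i.
Proof.
rewrite tnth_mktuple -mul_mpolyC (rmorphM ev) ev_mesym.
have lt_ni : (n - i < n.+1)%N by rewrite ltnS leq_subr.
have := mroots_coeff xs (Ordinal lt_ni).
rewrite /= subKn ?(ltnW (ltn_ord i)) // -xsP coef_map coef_general_poly => Da.
rewrite -[RHS]/(in_alg L (indet i)) Da; congr (_ * _).
by rewrite !(rmorphXn, rmorphN1).
Qed.

(** Both sides are ring morphisms in [p] that agree on constants and, by Viete, on the variables. *)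
Lemma ev_comp_signed_mesym (p : A) : ev (p \mPo signed_mesym) = inA p.
Proof.
rewrite {2}[p]mpolyE /comp_mpoly /mmap !rmorph_sum; apply: eq_bigr => m _.
rewrite -mul_mpolyC !rmorphM; congr (_ * _); first by rewrite [LHS]mmapC.
rewrite mpolyXE_id !rmorph_prod; apply: eq_bigr => i _.
by rewrite !rmorphXn ev_signed_mesym.
Qed.

Lemma comp_signed_mesym_symmetric (p : A) : p \mPo signed_mesym \is symmetric.
Proof.
apply: mcomp_sym => i; rewrite -tnth_nth tnth_mktuple.
by rewrite rpredZ ?mesym_sym.
Qed.

Lemma comp_signed_mesym_onto (q : A) :
  q \is symmetric -> exists p, p \mPo signed_mesym = q.
Proof.
case/sym_fundamental => t [<- _].
(* [sym_fundamental] lists the elementary symmetric polynomials unsigned and upwards from degree 1;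
   [r] reverses the order and cancels the signs. *)
pose r := [tuple (-1) ^+ i.+1 *: ('X_(rev_ord i) : A) | i < n].
exists (t \mPo r); rewrite comp_mpolyA; congr (_ \mPo _).
apply: eq_from_tnth => i; rewrite tnth_map !tnth_mktuple comp_mpolyZ.
rewrite comp_mpolyXU -tnth_nth tnth_mktuple /= subKn // scalerA -exprMn mulrNN.
by rewrite tnth_ord_tuple mulr1 expr1n scale1r.
Qed.

Lemma ev_inj : injective ev.
Proof.
apply/raddf_inj => q ev_q0; apply/eqP.
pose N := \prod_(s : 'S_n) msym s q.
have symN : N \is symmetric.
  apply/issymP => s; rewrite rmorph_prod [RHS](reindex_inj (mulIg s)) /=.
  by apply: eq_bigr => u _; rewrite msymMm.
have [p Dp] := comp_signed_mesym_onto symN.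
have /eqP : ev N = 0.
  by rewrite /N (bigD1 1%g) //= msym1m rmorphM /= ev_q0 mul0r.
(* [inA] is injective, so [p] and hence [N] vanish; then some conjugate of [q], and so [q] itself,
   is zero. *)
rewrite -Dp ev_comp_signed_mesym fmorph_eq0 tofrac_eq0 => /eqP p0.
move/eqP: Dp; rewrite p0 rmorph0 eq_sym => /prodf_eq0[s _].
by move=> /eqP msym_q0; apply/eqP/(inj_msym s); rewrite msym_q0 msym0.
Qed.

Lemma roots_inj : injective (tnth xs).
Proof.
move=> i j; rewrite -!ev_X => /ev_inj /(congr1 (mcoeff U_(i))).
by rewrite !mcoeffXU eqxx; case: eqVneq.
Qed.

(** A Galois resolvent: the distinct weights [0, ..., n-1] tell its images under different
    permutations apart, so a single conjugate of its value encodes a permutation of the roots. *)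
Let wsum (t : 'I_n -> 'I_n) : A := \sum_i 'X_(t i) *+ i.

Lemma mcoeff_wsum (t : 'I_n -> 'I_n) j :
  injective t -> (wsum t)@_U_(t j) = j%:R.
Proof.
move=> t_inj; rewrite raddf_sum (bigD1 j) //= big1 => [|i neq_ij].
  by rewrite addr0 mcoeffMn mcoeffXU eqxx.
by rewrite mcoeffMn mcoeffXU (inj_eq t_inj) (negPf neq_ij) mul0rn.
Qed.

Lemma wsum_inj (t : 'I_n -> 'I_n) (s : 'S_n) :
  injective t -> wsum t = wsum s -> t =1 s.
Proof.
move=> t_inj eq_ts i; pose k := ((perm t_inj)^-1)%g (s i).
have Dk : t k = s i by rewrite -(permE t_inj) permKV.
(* The coefficient of ['X_(s i)] is [k] in [wsum t] and [i] in [wsum s]. *)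
have : k%:R = i%:R :> rat.
  by rewrite -(mcoeff_wsum k t_inj) eq_ts Dk mcoeff_wsum //; apply: perm_inj.
move/eqP; rewrite Num.Theory.eqr_nat => /eqP/val_inj eq_ki.
by rewrite -Dk eq_ki.
Qed.

Lemma ev_wsum t : ev (wsum t) = \sum_i tnth xs (t i) *+ i.
Proof.
rewrite rmorph_sum; apply: eq_bigr => i _; rewrite rmorphMn; congr (_ *+ _).
exact: ev_X.
Qed.

(* The minimal polynomial of [ev (wsum id)] gives, after clearing denominators,
   a relation between the roots; as the roots are algebraically independent,
   it persists when they are permuted. *)
Lemma root_minPoly_wsum (s : 'S_n) :
  root (minPoly 1 (ev (wsum id))) (ev (wsum s)).
Proof.
have /polyOver1P[p Dp] := minPolyOver 1 (ev (wsum id)).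
have [d [q [d_neq0 Dq]]] := fraction_poly_clear_denom p.
(* Each [a_i] is replaced by a symmetric polynomial in the roots, which makes [q1] invariant under
   [msym s]. *)
pose q1 : {poly A} := map_poly (comp_mpoly signed_mesym) q.
have ev_q1 v : (map_poly ev q1).[v] = tofrac d *: (minPoly 1 (ev (wsum id))).[v].
  rewrite -mulr_algl -[_%:A]/(in_alg L (tofrac d)) -hornerZ Dp.
  rewrite -[_ *: map_poly _ p](map_polyZ (in_alg L)) -Dq -!map_poly_comp.
  by congr _.[v]; apply: eq_map_poly => a; apply: ev_comp_signed_mesym.
have q1_wsum : q1.[wsum id] = 0.
  apply: ev_inj; rewrite rmorph0 -horner_map /= ev_q1.
  by have /rootP-> := root_minPoly 1 (ev (wsum id)); rewrite scaler0.
have q1_sym : map_poly (msym s) q1 = q1.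
  apply/polyP=> i; rewrite !coef_map /=.
  exact/issymP/comp_signed_mesym_symmetric.
have msym_wsum : msym s (wsum id) = wsum s.
  rewrite /wsum raddf_sum; apply: eq_bigr => i _.
  by rewrite raddfMn /= /msym mmapX mmap1U.
have /eqP := ev_q1 (ev (wsum s)).
rewrite horner_map /= -msym_wsum -q1_sym horner_map q1_wsum !rmorph0 eq_sym.
by rewrite scaler_eq0 tofrac_eq0 (negPf d_neq0) rootE.
Qed.

(** By normality some automorphism carries the value of the resolvent to its conjugate for [s]; it
    permutes the roots by some [t], and algebraic independence forces [t] to be [s]. *)
Lemma gal_general_poly (s : 'S_n) :
  exists2 g, g \in 'Gal({:L} / 1)%g & forall i, g (tnth xs i) = tnth xs (s i).
Proof.
have [g Gg g_wsum] := normalField_root_minPoly (sub1v _) (normalFieldf 1)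
  (memvf (ev (wsum id))) (root_minPoly_wsum s).
exists g => //.
have g_xs i : exists j, g (tnth xs i) = tnth xs j.
  apply/tnthP; rewrite -root_prod_XsubC -xsP.
  have -> : map_poly (in_alg L) (general_poly n) =
            map_poly g (map_poly (in_alg L) (general_poly n)).
    rewrite -map_poly_comp; apply: eq_map_poly => c /=.
    by rewrite linearZ /= rmorph1.
  by rewrite fmorph_root xsP root_prod_XsubC mem_tnth.
have [t Dt] := fin_all_exists g_xs.
have t_inj : injective t.
  by move=> i j eq_t; apply/roots_inj/(fmorph_inj g); rewrite /= !Dt eq_t.
suffices eq_ts : t =1 s by move=> i; rewrite Dt eq_ts.
apply: wsum_inj => //; apply: ev_inj; rewrite -g_wsum !ev_wsum rmorph_sum.
by apply: eq_bigr => i _; rewrite rmorphMn /= Dt.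
Qed.

End GeneralPoly.

(** * Transfer to the derived series of the symmetric group *)

(** Induction on [k]: the permutations that lift to the next derived subgroup form a group, and it
    contains the commutators of permutations lifted before. *)
Lemma der_gal_lift_perm (K : fieldType) (L : splittingFieldType K) (n : nat)
    (x : 'I_n -> L) :
    (forall s : 'S_n, exists2 g, g \in 'Gal({:L} / 1)%g &
       forall i, g (x i) = x (s i)) ->
  forall k (s : 'S_n), s \in ([set: 'S_n]^`(k))%g ->
    exists2 g, g \in ('Gal({:L} / 1)^`(k))%g & forall i, g (x i) = x (s i).
Proof.
move=> lift_perm; elim=> [|k IHk] s; first by move=> _; apply: lift_perm.
pose G k := ('Gal({:L} / 1)^`(k))%G.
pose lifts (g : gal_of {:L}) (s : 'S_n) := [forall i, g (x i) == x (s i)].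
pose H := [set s : 'S_n | [exists g in G k.+1, lifts g s]].
(* Automorphisms and permutations both multiply from left to right, so products lift to products in
   the same order. *)
have liftsM g h s1 s2 : lifts g s1 -> lifts h s2 -> lifts (g * h)%g (s1 * s2)%g.
  move=> /forallP g_s1 /forallP h_s2; apply/forallP=> i.
  by rewrite galM ?memvf // (eqP (g_s1 i)) (eqP (h_s2 _)) permM.
have liftsV g s1 : lifts g s1 -> lifts (g^-1)%g (s1^-1)%g.
  move=> /forallP g_s1; apply/forallP=> i.
  by rewrite -{1}(permKV s1 i) -(eqP (g_s1 _)) -galM ?memvf // mulgV gal_id.
have groupH : group_set H.
  apply/group_setP; split=> [|s1 s2].
    rewrite inE; apply/exists_inP; exists 1%g; first exact: group1.
    by apply/forallP=> i; rewrite gal_id perm1.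
  rewrite !inE => /exists_inP[g Gg g_s1] /exists_inP[h Gh h_s2].
  by apply/exists_inP; exists (g * h)%g; rewrite ?groupM ?liftsM.
suffices /subsetP sub_H : ([set: 'S_n]^`(k.+1))%g \subset H.
  move/sub_H; rewrite inE => /exists_inP[g Gg /forallP g_s].
  by exists g => // i; apply/eqP.
rewrite dergSn (gen_subG _ (Group groupH)).
apply/subsetP=> _ /imset2P[s1 s2 /IHk[g1 Gg1 g1_s1] /IHk[g2 Gg2 g2_s2] ->].
have g1s1 : lifts g1 s1 by apply/forallP=> i; rewrite g1_s1.
have g2s2 : lifts g2 s2 by apply/forallP=> i; rewrite g2_s2.
rewrite inE; apply/exists_inP; exists [~ g1, g2]%g.
  by rewrite /G /= dergSn mem_commg.
by rewrite /commg /conjg !(liftsM, liftsV).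
Qed.

Lemma size_general_poly_tail n :
  (size (\sum_(i < n) (indet i)%:P * 'X^i : {poly rat_funs n})%R <= n)%N.
Proof.
apply: leq_trans (size_sum _ _ _) _; apply/bigmax_leqP => i _.
by rewrite mul_polyC (leq_trans (size_scale_leq _ _)) // size_polyXn.
Qed.

Lemma monic_general_poly n : general_poly n \is monic.
Proof.
by rewrite monicE lead_coefDl ?lead_coefXn // size_polyXn ltnS size_general_poly_tail.
Qed.

Lemma size_general_poly n : size (general_poly n) = n.+1.
Proof. by rewrite size_polyDl size_polyXn // ltnS size_general_poly_tail. Qed.

Theorem mainTheorem2 (n : nat) (hn : (5 <= n)%N) :
  ~ solvable_in_radicals (general_poly n).
Proof.
have pchar0 : [pchar (rat_funs n)] =i pred0.
  move=> p; rewrite !inE; apply/negP=> /andP[p_pr].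
  rewrite -(rmorph_nat (@tofrac {mpoly rat[n]})) tofrac_eq0.
  rewrite -(rmorph_nat (@mpolyC n rat)) mpolyC_eq0 Num.Theory.pnatr_eq0.
  by case: p p_pr.
move/(solvable_in_radicals_der pchar0) => [L [rs [k [Drs fix_rs]]]].
have {}Drs : map_poly (in_alg L) (general_poly n) = \prod_(r <- rs) ('X - r%:P).
  by apply/eqP; rewrite -eqp_monic ?monic_prod_XsubC ?map_monic ?monic_general_poly.
have size_rs : size rs = n.
  by apply: succn_inj; rewrite -(size_prod_XsubC rs id) -Drs size_map_poly
    size_general_poly.
pose xs : n.-tuple L := tcast size_rs (in_tuple rs).
have Dxs : xs = rs :> seq L by rewrite val_tcast.
have xsP : map_poly (in_alg L) (general_poly n) = \prod_(x <- xs) ('X - x%:P).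
  by rewrite Dxs.
have lift_k := der_gal_lift_perm (gal_general_poly xsP) (k := k).
(* Such a permutation lifts to an automorphism that fixes all roots; as the roots are distinct, it
   is the identity. *)
have der_Sn : ([set: 'S_n]^`(k) = 1)%g.
  apply/trivgP/subsetP=> s /lift_k[g Gg g_s]; apply/set1P/permP=> i.
  apply: (roots_inj xsP); rewrite perm1 -g_s fix_rs // -Dxs.
  exact: mem_tnth.
have := @solvable_SymF 'I_n; rewrite card_ord => /(_ hn)/negbT/negP; apply.
by apply/derivedP; exists k.
Qed.
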